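(* Let $p$ and $q$ be primes and let $R$ be a ring with unity such that $|R|=p^3q$ and $|Z(R)|=pq$. Then $$\sigma_{\mathrm{snm}}(\Gamma_R)=\Big\{[-(p^2q-pq-1)^2]^{(p+1)(p^2q-pq-1)},\ [(p^2q-pq-1)^3]^{p+1}\Big\}$$ and $E_{\mathrm{sn}}(\Gamma_R)=2(p+1)(p^2q-pq-1)^3$.
   Context: For a ring $R$, $Z(R)$ is its center. For a finite non-commutative ring $R$, the commuting graph $\Gamma_R$ is the simple graph with vertex set $R\setminus Z(R)$ in which two distinct vertices are adjacent if they commute. Let $\Gamma$ be a finite simple graph with vertices $v_1,\dots,v_n$. Let $N(v_i)$ be the set of vertices adjacent to $v_i$, let $N^2(v_i)=\big(\bigcup_{u\in N(v_i)}N(u)\big)\setminus\{v_i\}$, and let $\delta_2(v_i)=\sum_{x\in N^2(v_i)}\deg x$. The minimum second neighborhood degree matrix $\mathrm{snm}(\Gamma)$ is the $n\times n$ matrix whose $(i,j)$ entry is $\min\{\delta_2(v_i),\delta_2(v_j)\}$ if $i\neq j$ and $v_i,v_j$ are adjacent, and $0$ otherwise. The MSN-spectrum $\sigma_{\mathrm{snm}}(\Gamma)$ is the multiset of eigenvalues of $\mathrm{snm}(\Gamma)$; $\{[\sigma_1]^{\alpha_1},\dots,[\sigma_k]^{\alpha_k}\}$ means eigenvalue $\sigma_i$ with multiplicity $\alpha_i$ (multiplicities of repeated values are added, entries with multiplicity $0$ are omitted). The MSN-energy is $E_{\mathrm{sn}}(\Gamma)=$ the sum of the absolute values of the eigenvalues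 of $\mathrm{snm}(\Gamma)$, counted with multiplicity. *)

(* Defs.v *)
From HB Require Import structures.
From mathcomp Require Import all_boot all_order all_algebra.
From mathcomp Require Import finmap multiset.

Set Implicit Arguments.
Unset Strict Implicit.
Unset Printing Implicit Defensive.

Import GRing.Theory Num.Theory.
Local Open Scope ring_scope.

Record sgraph := SGraph {
  svertex :> finType;
  sedge : rel svertex;
  sedge_sym : symmetric sedge;
  sedge_irrefl : irreflexive sedge
}.

Section MinimumSecondNeighborhood.

Variable G : sgraph.
Implicit Types v : G.

Definition nbhd v : {set G} := [set u | sedge v u].

Definition degree v : nat := #|nbhd v|.

Definition nbhd2 v : {set G} := (\bigcup_(u in nbhd v) nbhd u) :\ v.

Definition delta2 v : nat := (\sum_(x in nbhd2 v) degree x)%N.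

(* Vertices are numbered by the standard enumeration of the finite type. *)
Definition snm (C : pzRingType) : 'M[C]_#|G| :=
  \matrix_(i, j)
    if (i != j) && sedge (enum_val i) (enum_val j)
    then (minn (delta2 (enum_val i)) (delta2 (enum_val j)))%:R
    else 0.

End MinimumSecondNeighborhood.

(* The eigenvalues counted with algebraic multiplicity, i.e. the multiset of
   roots of the (monic) characteristic polynomial. *)
Definition mx_spectrum (C : numClosedFieldType) (n : nat) (A : 'M[C]_n) :
    {mset C}%mset :=
  seq_mset (sval (closed_field_poly_normal (char_poly A))).

Definition msn_spectrum (C : numClosedFieldType) (G : sgraph) : {mset C}%mset :=
  mx_spectrum (snm G C).

Definition msn_energy (C : numClosedFieldType) (G : sgraph) : C :=
  \sum_(x <- msn_spectrum C G) `|x|.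

Definition ring_center (R : finPzRingType) : {set R} :=
  [set z | [forall x, z * x == x * z]].

Section CommutingGraph.

Variable R : finPzRingType.

Definition noncentral : finType := {x : R | x \notin ring_center R}.

Definition commuting_edge : rel noncentral :=
  fun x y => (x != y) && (val x * val y == val y * val x).

Lemma commuting_edge_sym : symmetric commuting_edge.
Proof. by move=> x y; rewrite /commuting_edge eq_sym; congr (_ && _); rewrite eq_sym. Qed.

Lemma commuting_edge_irrefl : irreflexive commuting_edge.
Proof. by move=> x; rewrite /commuting_edge eqxx. Qed.

Definition commuting_graph : sgraph :=
  SGraph commuting_edge_sym commuting_edge_irrefl.

End CommutingGraph.

(* Main.v *)
(* In a ring of order p^3 q with center of order pq, every proper subgroup of (R, +)
   strictly above the center has index p over it.  Hence the centralizers of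
   noncentral elements have order p^2 q and two of them agree as soon as the
   elements commute, so the commuting graph is a disjoint union of p + 1 cliques
   of size m = p^2 q - pq.  On such a graph snm = (m-1)^2 (J - 1), where J is
   the block matrix of the equivalence relation and J^2 = m J; the eigenvalues
   are thus among -(m-1)^2 and (m-1)^3, and the vanishing of the trace forces
   their multiplicities. *)
Require Import Defs.
From HB Require Import structures.
From mathcomp Require Import all_boot all_order all_algebra.
From mathcomp Require Import finmap multiset.
From mathcomp Require Import fingroup zify ring.

Local Open Scope ring_scope.

Import GRing.Theory Num.Theory.

(** * Multisets, and spectra determined by a quadratic relation and the trace *)

Lemma perm_eq_nseq2 (T : eqType) (a b : T) (s : seq T) :
  {in s, forall x, x = a \/ x = b} ->
  exists m n, perm_eq s (nseq m a ++ nseq n b).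
Proof.
move=> sab; exists (count_mem a s), (count (predC (pred1 a)) s).
rewrite -!size_filter -(perm_filterC (pred1 a) s).
have /all_pred1P <- := filter_all (pred1 a) s.
suff /all_pred1P <- : all (pred1 b) (filter (predC (pred1 a)) s) by [].
apply/allP=> x; rewrite mem_filter /= => /andP[/eqP xa /sab].
by case=> // /eqP.
Qed.

Lemma perm_enum_msetD (K : choiceType) (A B : {mset K}%mset) :
  perm_eq (A `+` B)%mset (A ++ B).
Proof.
apply/eq_seq_msetP/msetP=> x.
by rewrite seq_mset_id mset_seqE count_cat -!mset_seqE !seq_mset_id msetE2.
Qed.

(** The quadratic identity says (A + w)(A - wk) = 0, so only - w and wk can be eigenvalues. If they
    occur [c] and [d] times, trace zero gives c = dk, and c + d = b(k + 1) then forces d = b. *)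
Lemma mx_spectrum_nseq2 (C : numClosedFieldType) (n k b : nat) (w : C)
    (A : 'M[C]_n) :
  w != 0 -> n = (b * k.+1)%N -> \tr A = 0 ->
  A *m A = (w * (k%:R - 1)) *: A + (w ^+ 2 * k%:R)%:M ->
  mx_spectrum A = (msetn (b * k) (- w) `+` msetn b (w * k%:R))%mset.
Proof.
move=> w0 nE trA AA; rewrite /mx_spectrum.
case: closed_field_poly_normal => s /=.
have /monicP -> := char_poly_monic A; rewrite scale1r => sE.
have szs : size s = n.
  by have := size_char_poly A; rewrite sE size_prod_XsubC => -[].
have sum0 : \sum_(x <- s) x = 0.
  (* The trace is read off the coefficient just below the leading one, which exists only for n >
     0. *)
  case: (posnP n) => [n0|n_gt0].
    by rewrite (size0nil (etrans szs n0)) big_nil.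
  apply/eqP; rewrite -oppr_eq0 -coefPn_prod_XsubC -?sE ?szs -?lt0n //.
  by rewrite char_poly_trace // trA oppr0.
have sP : {in s, forall x, x = - w \/ x = w * k%:R}.
  move=> x; rewrite -root_prod_XsubC -sE -eigenvalue_root_char.
  case/eigenvalueP=> v vA v0.
  have : (v *m A) *m A = v *m ((w * (k%:R - 1)) *: A + (w ^+ 2 * k%:R)%:M).
    by rewrite -mulmxA AA.
  rewrite mulmxDr -scalemxAr mul_mx_scalar vA -scalemxAl vA !scalerA -scalerDl.
  move/eqP; rewrite -subr_eq0 -scalerBl scaler_eq0 (negbTE v0) orbF => /eqP e.
  have /eqP : (x + w) * (x - w * k%:R) = 0 by rewrite -e; ring.
  by rewrite mulf_eq0 addr_eq0 subr_eq0 => /orP[] /eqP ->; [left|right].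
have [c [d scd]] := perm_eq_nseq2 _ _ _ _ sP.
have cdn : (c + d = b * k.+1)%N.
  by rewrite -nE -szs (perm_size scd) size_cat !size_nseq.
have cE : c = (d * k)%N.
  move: sum0; rewrite (perm_big _ scd) big_cat !big_nseq !iter_addr_0 /=.
  rewrite addrC => /eqP; rewrite mulNrn subr_eq0 -[w *+ c]mulr_natr.
  rewrite -[_ *+ d]mulr_natr -mulrA => /eqP /(mulfI w0) /eqP.
  by rewrite -natrM eqr_nat mulnC => /eqP.
have dE : d = b.
  have /eqP : (d * k.+1 = b * k.+1)%N by rewrite -cdn cE; lia.
  by rewrite eqn_pmul2r // => /eqP.
rewrite (eq_seq_msetP _ _ scd); apply/msetP=> x.
rewrite mset_seqE count_cat !count_nseq msetE2 !msetnE cE dE /= ![x == _]eq_sym.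
by do 2!case: (_ == x); rewrite /= ?mul1n ?mul0n.
Qed.

(** Lagrange's theorem in the additive group of [U]; by finiteness, closure under sums already
    provides opposites. *)
Lemma card_dvd_addr (U : finZmodType) (A B : {set U}) :
  0 \in A -> {in A &, forall x y, x + y \in A} ->
  0 \in B -> {in B &, forall x y, x + y \in B} ->
  A \subset B -> (#|A| %| #|B|)%N.
Proof.
move=> A0 AD B0 BD sAB.
pose gT : finGroupType := FinGroup.clone U _.
have gA : @group_set gT A by apply/group_setP.
have gB : @group_set gT B by apply/group_setP.
exact: (@cardSg gT (Group gB) (Group gA) sAB).
Qed.

(** * Disjoint unions of cliques of equal size *)

Section DisjointUnionOfCliques.

Variables (G : sgraph) (k b : nat).
Hypothesis sedge_trans : forall u v w : G,
  sedge u v -> sedge v w -> u != w -> sedge u w.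
Hypothesis degreeE : forall v : G, degree v = k.
Hypothesis k_gt1 : (1 < k)%N.

Lemma nbhd2_clique (v : G) : nbhd2 v = nbhd v.
Proof.
apply/setP=> u; rewrite !inE; apply/andP/idP => [[uv]|vu].
  case/bigcupP=> w; rewrite !inE => vw wu.
  by apply: sedge_trans vw wu _; rewrite eq_sym.
split; first by apply: contraTneq vu => ->; rewrite sedge_irrefl.
(* Since k > 1, [v] has a neighbour other than [u], the midpoint of a path of length two from [v] to
   [u]. *)
have : (0 < #|nbhd v :\ u|)%N.
  have := cardsD1 u (nbhd v); rewrite -/(degree v) degreeE.
  by case: (u \in _) => e; lia.
case/card_gt0P=> w; rewrite !inE => /andP[wu vw].
apply/bigcupP; exists w; rewrite !inE //.
by apply: sedge_trans vu wu; rewrite sedge_sym.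
Qed.

Lemma delta2_clique (v : G) : delta2 v = (k ^ 2)%N.
Proof.
rewrite /delta2 nbhd2_clique (eq_bigr (fun=> k)) => [|x _]; last exact: degreeE.
by rewrite sum_nat_const -/(degree v) degreeE mulnn.
Qed.

Lemma snm_clique_trace (C : numClosedFieldType) : \tr (snm G C) = 0.
Proof. by rewrite /mxtrace big1 // => i _; rewrite mxE eqxx. Qed.

(** The reflexive closure of adjacency, an equivalence relation whose classes are the cliques. *)
Let clique (u v : G) := (u == v) || sedge u v.

(** The entrywise form of J^2 = (k + 1) J: the set is the whole class of [u] when [v] belongs to it,
    and empty otherwise. *)
Lemma card_common_clique (u v : G) :
  #|[set x | clique u x && clique x v]| = (clique u v * k.+1)%N.
Proof.
have cl_sym x y : clique x y = clique y x by rewrite /clique eq_sym sedge_sym.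
have cl_trans x y z : clique x y -> clique y z -> clique x z.
  rewrite /clique => /orP[/eqP->//|xy] /orP[/eqP<-|yz]; first by rewrite xy orbT.
  by case: eqVneq => //= xz; apply: sedge_trans xy yz xz.
case: (boolP (clique u v)) => uv; last first.
  apply: eq_card0 => x; rewrite inE; apply: contraNF uv => /andP[].
  exact: cl_trans.
rewrite mul1n -(degreeE u) /degree.
have -> : [set x | clique u x && clique x v] = u |: nbhd u.
  apply/setP=> x; rewrite !inE [x == u]eq_sym -/(clique u x) andb_idr // => ux.
  by rewrite cl_sym in ux; apply: cl_trans ux uv.
by rewrite cardsU1 !inE sedge_irrefl.
Qed.

Lemma snm_cliqueE (C : numClosedFieldType) :
  snm G C = (k ^ 2)%:R *:
    (\matrix_(i, j) (clique (enum_val i) (enum_val j))%:R - 1%:M).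
Proof.
apply/matrixP=> i j; rewrite !mxE !delta2_clique minnn /clique.
rewrite (inj_eq enum_val_inj); case: eqVneq => _ /=.
  by rewrite subrr mulr0.
by case: (sedge _ _); rewrite /= subr0 ?mulr1 ?mulr0.
Qed.

Lemma snm_clique_sqr (C : numClosedFieldType) :
  let w : C := (k ^ 2)%:R in
  snm G C *m snm G C = (w * (k%:R - 1)) *: snm G C + (w ^+ 2 * k%:R)%:M.
Proof.
move=> w; rewrite snm_cliqueE -/w; set J := \matrix_(i, j) _.
have JJ : J *m J = k.+1%:R *: J.
  apply/matrixP=> i j; rewrite !mxE -natrM mulnC -card_common_clique.
  (* Passing from indices to vertices turns the matrix product into a count. *)
  transitivity (\sum_(x in G)
      (clique (enum_val i) x && clique x (enum_val j))%:R : C).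
    rewrite [RHS]big_enum_val; apply: eq_bigr => l _.
    by rewrite !mxE -natrM mulnb.
  rewrite -natr_sum -sum1dep_card [in RHS]big_mkcond.
  by congr _%:R.
rewrite -scalemxAl -scalemxAr mulmxBl !mulmxBr JJ !mulmx1 mul1mx.
rewrite -[(w ^+ 2 * _)%:M]scalemx1; clearbody J w.
by apply/matrixP=> i j; rewrite !mxE -natr1; ring.
Qed.

Lemma msn_spectrum_clique (C : numClosedFieldType) :
  #|G| = (b * k.+1)%N ->
  msn_spectrum C G =
    (msetn (b * k) (- k%:R ^+ 2) `+` msetn b (k%:R ^+ 3))%mset.
Proof.
move=> cardG; rewrite (@exprSr _ k%:R 2) -natrX.
apply: mx_spectrum_nseq2 cardG (snm_clique_trace C) (snm_clique_sqr C).
by rewrite pnatr_eq0; lia.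
Qed.

End DisjointUnionOfCliques.

(** * Centralizers and the structure of the commuting graph *)

Section CentralizerOrder.

Variables (p q : nat) (R : finPzRingType).
Hypotheses (hp : prime p) (hq : prime q).
Hypotheses (hR : #|R| = (p ^ 3 * q)%N) (hZ : #|ring_center R| = (p * q)%N).

Definition ring_cent1 (x : R) : {set R} := [set y | x * y == y * x].

Lemma ring_cent1_0 x : 0 \in ring_cent1 x.
Proof. by rewrite inE mulr0 mul0r. Qed.

Lemma ring_cent1_add x : {in ring_cent1 x &, forall y z, y + z \in ring_cent1 x}.
Proof. by move=> y z; rewrite !inE mulrDr mulrDl => /eqP-> /eqP->. Qed.

Lemma ring_cent1_id x : x \in ring_cent1 x.
Proof. by rewrite inE. Qed.

Lemma ring_cent1_sym x y : (y \in ring_cent1 x) = (x \in ring_cent1 y).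
Proof. by rewrite !inE eq_sym. Qed.

Lemma center_sub_cent1 x : ring_center R \subset ring_cent1 x.
Proof. by apply/subsetP=> z; rewrite !inE eq_sym => /forallP. Qed.

Lemma center_0 : 0 \in ring_center R.
Proof. by rewrite inE; apply/forallP=> x; rewrite mulr0 mul0r. Qed.

Lemma center_add : {in ring_center R &, forall y z, y + z \in ring_center R}.
Proof.
move=> y z; rewrite !inE => /forallP yZ /forallP zZ.
by apply/forallP=> x; rewrite mulrDr mulrDl (eqP (yZ x)) (eqP (zZ x)).
Qed.

Lemma cent1_proper (x : R) : x \notin ring_center R -> ring_cent1 x \proper setT.
Proof.
apply: contraR; rewrite properT negbK => /eqP xT; rewrite inE.
by apply/forallP=> y; have := in_setT y; rewrite -xT inE.
Qed.

(** Two uses of Lagrange leave 1, p or p^2 as index over the center; the strict inclusions exclude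
    the first and the last. *)
Lemma card_between_center (A : {set R}) :
  0 \in A -> {in A &, forall x y, x + y \in A} ->
  ring_center R \proper A -> A \proper setT -> #|A| = (p ^ 2 * q)%N.
Proof.
move=> A0 AD ZA AT.
have [k kE] : exists k, #|A| = (k * (p * q))%N.
  apply/dvdnP; rewrite -hZ; apply: card_dvd_addr (proper_sub ZA) => //.
    exact: center_0.
  exact: center_add.
have pq_gt0 : (0 < p * q)%N by rewrite muln_gt0 !prime_gt0.
have /(dvdn_pfactor _ _ hp) [[|[|[|//]]] _ kp] : (k %| p ^ 2)%N.
- rewrite -(@dvdn_pmul2r (p * q)) // -kE (_ : (_ * _ = #|[set: R]|)%N).
    by apply: card_dvd_addr A0 AD _ _ (subsetT A) => [|x y _ _]; rewrite in_setT.
  by rewrite cardsT hR; ring.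
- by have := proper_card ZA; rewrite kE kp hZ mul1n ltnn.
- by rewrite kE kp; ring.
have := proper_card AT; rewrite kE kp cardsT hR.
by rewrite (_ : (_ * _ = p ^ 3 * q)%N) ?ltnn //; ring.
Qed.

Lemma center_proper_cent1 (x : R) :
  x \notin ring_center R -> ring_center R \proper ring_cent1 x.
Proof.
by move=> xZ; rewrite properE center_sub_cent1; apply/subsetPn; exists x;
  rewrite ?ring_cent1_id.
Qed.

Lemma card_cent1 (x : R) :
  x \notin ring_center R -> #|ring_cent1 x| = (p ^ 2 * q)%N.
Proof.
move=> xZ; apply: card_between_center; first exact: ring_cent1_0.
- exact: ring_cent1_add.
- exact: center_proper_cent1.
- exact: cent1_proper.
Qed.

(* Both centralizers and their intersection lie strictly between the center and
   the ring, so all three have the same order. *)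
Lemma cent1_eq (x y : R) :
  x \notin ring_center R -> y \notin ring_center R -> y \in ring_cent1 x ->
  ring_cent1 x = ring_cent1 y.
Proof.
move=> xZ yZ xy.
have cardI : #|ring_cent1 x :&: ring_cent1 y| = (p ^ 2 * q)%N.
  apply: card_between_center; first by rewrite inE !ring_cent1_0.
  - by move=> u v /setIP[ux uy] /setIP[vx vy]; rewrite inE !ring_cent1_add.
  - rewrite properE subsetI !center_sub_cent1; apply/subsetPn; exists x => //.
    by rewrite inE ring_cent1_id -ring_cent1_sym.
  - exact: sub_proper_trans (subsetIl _ _) (cent1_proper x xZ).
have eqI z : z \notin ring_center R ->
    ring_cent1 x :&: ring_cent1 y \subset ring_cent1 z ->
    ring_cent1 x :&: ring_cent1 y = ring_cent1 z.
  by move=> zZ sIz; apply/eqP; rewrite eqEcard sIz cardI card_cent1 //=.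
by rewrite -(eqI x xZ (subsetIl _ _)) (eqI y yZ (subsetIr _ _)).
Qed.

Let G := commuting_graph R.

(** As [u] and [v] have the same centralizer, what commutes with [v] commutes with [u]. *)
Lemma commuting_graph_trans (u v w : G) :
  sedge u v -> sedge v w -> u != w -> sedge u w.
Proof.
rewrite /= /commuting_edge => /andP[_ uv] /andP[_ vw] -> /=.
have : val w \in ring_cent1 (val u).
  by rewrite (cent1_eq _ (val v)) ?(valP u) ?(valP v) // inE.
by rewrite inE.
Qed.

(** The neighbours of [v] form its centralizer without the center and without [v] itself, whence the
    final - 1. *)
Lemma degree_commuting_graph (v : G) : degree v = (p ^ 2 * q - p * q - 1)%N.
Proof.
have <- : #|ring_cent1 (val v) :\: ring_center R| = (p ^ 2 * q - p * q)%N.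
  by rewrite cardsD (setIidPr (center_sub_cent1 _)) card_cent1 ?(valP v) // hZ.
rewrite (cardsD1 (val v)) in_setD ring_cent1_id (valP v) /= add1n subn1 /=.
rewrite /degree -(card_imset (nbhd v) val_inj); apply: eq_card => y.
apply/imsetP/idP => [[u vu ->]|].
  move: vu; rewrite in_setD1 in_setD (valP u) !inE => /andP[vu ->].
  by rewrite eq_sym (inj_eq val_inj) vu.
rewrite in_setD1 in_setD => /and3P[yv yZ vy].
exists (Sub y yZ : G); last by rewrite SubK.
rewrite inE /= /commuting_edge -(inj_eq val_inj) SubK eq_sym yv /=.
by rewrite inE in vy.
Qed.

Lemma clique_size_pos : (p * q < p ^ 2 * q)%N.
Proof.
by rewrite expnS expn1 -mulnA ltn_Pmull ?prime_gt1 // muln_gt0 !prime_gt0.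
Qed.

Lemma card_commuting_graph :
  #|G| = ((p + 1) * (p ^ 2 * q - p * q - 1).+1)%N.
Proof.
have -> : #|G| = (p ^ 3 * q - p * q)%N.
  by rewrite card_sig -hR -hZ -(cardC (mem (ring_center R))) addKn.
have := clique_size_pos.
(* With a = pq the claim is p^2 a - a = (p + 1)(p a - a). *)
rewrite !expnS expn0 muln1 -!mulnA; move: (p * q)%N => a lt_a.
rewrite subn1 prednK ?subn_gt0 // mulnBr !mulnDl; lia.
Qed.

End CentralizerOrder.

Theorem theorem4p3 (C : numClosedFieldType) (p q : nat) (R : finPzRingType)
    (hp : prime p) (hq : prime q)
    (hR : #|R| = (p ^ 3 * q)%N) (hZ : #|ring_center R| = (p * q)%N) :
  msn_spectrum C (commuting_graph R) =
    (msetn ((p + 1) * (p ^ 2 * q - p * q - 1))%N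
           (- (p%:R ^+ 2 * q%:R - p%:R * q%:R - 1) ^+ 2)
     `+` msetn (p + 1)%N ((p%:R ^+ 2 * q%:R - p%:R * q%:R - 1) ^+ 3))%mset /\
  msn_energy C (commuting_graph R) =
    2 * (p%:R + 1) * (p%:R ^+ 2 * q%:R - p%:R * q%:R - 1) ^+ 3.
Proof.
have lt_pq := clique_size_pos _ _ hp hq.
set k := (p ^ 2 * q - p * q - 1)%N.
(* By [lt_pq] the natural subtractions do not truncate, so they agree with those in [C]. *)
have -> : p%:R ^+ 2 * q%:R - p%:R * q%:R - 1 = k%:R :> C.
  by rewrite /k !natrB ?subn_gt0 ?(ltnW lt_pq) // ![(_ * q)%:R]natrM natrX.
(* In fact k + 1 = pq(p - 1) is at least 4. *)
have k_gt1 : (1 < k)%N.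
  have := prime_gt1 hp; have := prime_gt1 hq; rewrite /k.
  by case: (p) => [|[|p']]; case: (q) => [|[|q']] // _ _; nia.
have spE : msn_spectrum C (commuting_graph R) =
    (msetn ((p + 1) * k) (- k%:R ^+ 2) `+` msetn (p + 1) (k%:R ^+ 3))%mset.
  apply: msn_spectrum_clique k_gt1 _ _.
  - exact: commuting_graph_trans hp hq hR hZ.
  - exact: degree_commuting_graph hp hq hR hZ.
  - exact: card_commuting_graph hp hq hR hZ.
(* Each of the two eigenvalues contributes (p + 1) k^3 to the energy. *)
split=> //; rewrite /msn_energy spE (perm_big _ (perm_enum_msetD _ _ _)) big_cat.
rewrite !enum_msetn !big_nseq !iter_addr_0 /=.
clearbody k; rewrite normrN !normrX normr_nat.
rewrite -(mulr_natr (k%:R ^+ 2)) -(mulr_natr (k%:R ^+ 3)).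
by rewrite (natrM _ (p + 1)) (natrD _ p 1); ring.
Qed.
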